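(* Let $n\ge 2$ and let $f(x)=\frac12x^\top\mathbf{A}x$ on $\mathbb{R}^n$, where $\mathbf{A}=\mathbf{A}^\top\succ 0$ has eigenvalues $\lambda_1\le\dots\le\lambda_n$. Let $F$ be a real number with $F>14$, $F\le\sqrt{\lambda_n/\lambda_1}$, and assume $\lambda_2\ge F^2\lambda_1$ and $\lambda_n\ge 10000\,\lambda_1$. Let $\alpha=\frac{1}{\lambda_n}$ and let $\beta$ satisfy $$\left(1-\sqrt{\lambda_2/\lambda_n}\right)^2<\beta\le\left(1-F\sqrt{\lambda_1/\lambda_n}\right)^2 .$$ Let $$\alpha^*=\frac{4}{(\sqrt{\lambda_n}+\sqrt{\lambda_1})^2},\qquad \beta^*=\left(\frac{\sqrt{\lambda_n}-\sqrt{\lambda_1}}{\sqrt{\lambda_n}+\sqrt{\lambda_1}}\right)^2 .$$ Then $$\mathrm{dev}_{\mathrm{AHB}}(\alpha,\beta)\le \mathrm{dev}_{\mathrm{HB}}(\alpha,\beta)\le\frac{2e\sqrt6}{\sqrt{F^2-1}}\,\mathrm{dev}_{\mathrm{HB}}(\alpha^*,\beta^* ).$$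
   Context: For $\alpha>0$, $\beta\in[0,1]$ and the given matrix $\mathbf{A}\in\mathbb{R}^{n\times n}$ define $$\mathbf{T}(\alpha,\beta)=\begin{bmatrix}(1+\beta)\mathbf{I}-\alpha\mathbf{A} & -\beta\mathbf{I}\\ \mathbf{I}&\mathbf{0}\end{bmatrix}\in\mathbb{R}^{2n\times 2n},\qquad \mathbf{C}=\begin{bmatrix}\mathbf{0}&\mathbf{I}\end{bmatrix}\in\mathbb{R}^{n\times 2n},$$ where $\mathbf{I}$ is the $n\times n$ identity. (The Heavy-Ball iterates $x_{k+1}=x_k-\alpha\nabla f(x_k)+\beta(x_k-x_{k-1})$, $k\ge1$, for $f(x)=\frac12x^\top\mathbf{A}x$, whose minimizer is $x_*=0$, satisfy $x_k=\mathbf{C}\mathbf{T}^k\begin{bmatrix} x_1 \\ x_0 \end{bmatrix}$; the averaged method AHB uses $\overline x_k=\frac1{k+1}\sum_{t=0}^k x_t$.) The worst-case maximal deviations are $$\mathrm{dev}_{\mathrm{HB}}(\alpha,\beta)=\max_{k\ge0}\left\|\mathbf{C}\,\mathbf{T}(\alpha,\beta)^k\right\|_2,\qquad \mathrm{dev}_{\mathrm{AHB}}(\alpha,\beta)=\max_{k\ge0}\left\|\frac1{k+1}\sum_{t=0}^k\mathbf{C}\,\mathbf{T}(\alpha,\beta)^t\right\|_2,$$ where $\|\cdot\|_2$ denotes the spectral norm and maxima over $k\ge0$ are understood as suprema. *)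

(* Defs.v *)
From mathcomp Require Import all_boot all_order all_algebra.
From mathcomp Require Import all_classical all_reals all_analysis.

Set Implicit Arguments.
Unset Strict Implicit.
Unset Printing Implicit Defensive.

Import Order.TTheory GRing.Theory Num.Theory.
Local Open Scope classical_set_scope.
Local Open Scope ring_scope.

(* The library norm on matrices is the entrywise maximum, hence [norm2]. *)
Definition norm2 (R : realType) (n : nat) (x : 'cV[R]_n) : R :=
  Num.sqrt (\sum_(i < n) x i 0 ^+ 2).

Definition spectral_norm (R : realType) (m n : nat) (M : 'M[R]_(m, n)) : R :=
  sup [set norm2 (M *m x) | x in [set x : 'cV[R]_n | norm2 x <= 1]].

Definition positive_definite (R : realType) (n : nat) (A : 'M[R]_n) : Prop :=
  A^T = A /\ forall x : 'cV[R]_n, x != 0 -> 0 < (x^T *m A *m x) 0 0.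

(* [lambda] lists the eigenvalues of [A] with algebraic multiplicity, in
   nondecreasing order; indices start at 0. *)
Definition sorted_eigenvalues (R : realType) (n : nat) (A : 'M[R]_n)
    (lambda : n.-tuple R) : Prop :=
  sorted <=%R lambda /\ char_poly A = \prod_(l <- lambda) ('X - l%:P).

Section HeavyBall.
Variables (R : realType) (n : nat) (A : 'M[R]_n).

Definition HB_T (alpha beta : R) : 'M[R]_(n + n) :=
  block_mx ((1 + beta)%:M - alpha *: A) (- beta%:M)
           1%:M                         0.

Definition HB_C : 'M[R]_(n, n + n) := row_mx 0 1%:M.

(* The suprema over k are taken in the extended reals: an unbounded sequence of
   norms gives +oo instead of the default value of [sup]. *)
Definition dev_HB (alpha beta : R) : \bar R :=
  ereal_sup (range (fun k : nat =>
    (spectral_norm (HB_C *m HB_T alpha beta ^+ k))%:E)).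

Definition dev_AHB (alpha beta : R) : \bar R :=
  ereal_sup (range (fun k : nat =>
    (spectral_norm
       (k.+1%:R^-1 *: \sum_(0 <= t < k.+1) HB_C *m HB_T alpha beta ^+ t))%:E)).

End HeavyBall.

(* Main.v *)
Require Import Defs.
From mathcomp Require Import all_boot all_order all_algebra.
From mathcomp Require Import all_classical all_reals all_analysis.
From mathcomp Require Import ring lra.

Import Order.TTheory GRing.Theory Num.Theory.
Local Open Scope ring_scope.

(** The first inequality is convexity of the norm: an average of matrices has
    spectral norm at most the largest of theirs.

    For the second, write q = sqrt (lambda_1 / lambda_n).  The block row
    C T^(k+1) equals [U_(k+1)(A), - beta U_k(A)], where U_k is the polynomial
    solving U_(k+2) = (1 + beta - alpha x) U_(k+1) - beta U_k from U_0 = 0 and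
    U_1 = 1 ([HB_row_horner]).  Since A is symmetric, the norm of such a row is
    controlled by the values of U_(k+1)^2 + beta^2 U_k^2 on the spectrum
    ([norm2_row_poly], which rests on the positivity statement
    [horner_mx_psd]), so that everything reduces to scalar recurrences
    with characteristic equation z^2 = (1 + beta - alpha lambda_i) z - beta.

    Upper bound ([dev_HB_upper]).  Put r = sqrt beta, so r <= 1 - F q.
    At lambda_1 the characteristic roots are real, in [0, 1], and the square of
    their difference is ((1-r)^2 - q^2) ((1+r)^2 - q^2), which is at least
    (F^2-1) q^2 (1 + r^2 - q^2); as U_k is a divided difference of k-th powers
    of the roots, it is at most the inverse of that difference
    ([real_mode_bound]).  At the other eigenvalues the roots are complex of
    modulus r, whence
    |U_(k+1)| <= (k+1) r^k <= 1 / (1-r) <= 1 / (F q) ([nonreal_mode_bound]).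
    In all cases the deviation is at most sqrt 2 / (sqrt (F^2-1) q).

    Lower bound ([dev_HB_optimal_lower]).  The parameters alpha^*, beta^* make
    lambda_1 a double root case, with root r = (1-q)/(1+q), so that
    U_(k+1)(lambda_1) = (k+1) r^k.  For k about 1/(4q), Bernoulli's inequality
    gives r^k >= 1/2, and an eigenvector of lambda_1 witnesses a deviation of
    at least 1/(8q).  The two bounds combine because
    8 sqrt 2 <= 2 e sqrt 6 ([numerical_comparison]). *)

(** * The scalar recurrence and its solutions *)

(** Impulse response of the recurrence x_(k+2) = x_(k+1) p - x_k b.  The ring is
    arbitrary because the same recurrence is run with matrices, polynomials and
    scalars, and ring morphisms transport one to the other. *)
Fixpoint impulse (S : pzRingType) (p b : S) (k : nat) : S :=
  if k is k1.+1 then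
    if k1 is k2.+1 then impulse S p b k1 * p - impulse S p b k2 * b else 1
  else 0.
Arguments impulse {S} p b k.

Lemma impulseSS (S : pzRingType) (p b : S) k :
  impulse p b k.+2 = impulse p b k.+1 * p - impulse p b k * b.
Proof. by []. Qed.

Lemma rmorph_impulse (S S' : pzRingType) (f : {rmorphism S -> S'}) p b k :
  f (impulse p b k) = impulse (f p) (f b) k.
Proof.
suff: f (impulse p b k) = impulse (f p) (f b) k /\
      f (impulse p b k.+1) = impulse (f p) (f b) k.+1 by case.
elim: k => [|k [IH0 IH1]]; first by rewrite /= rmorph0 rmorph1.
by split=> //; rewrite !impulseSS rmorphB !rmorphM IH0 IH1.
Qed.

Section Scalar.
Variable R : realFieldType.
Implicit Types p b q r s F : R.

Lemma impulse_double_root r k :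
  impulse (2 * r) (r ^+ 2) k.+1 = k.+1%:R * r ^+ k.
Proof.
suff: impulse (2 * r) (r ^+ 2) k.+1 = k.+1%:R * r ^+ k /\
      impulse (2 * r) (r ^+ 2) k.+2 = k.+2%:R * r ^+ k.+1 by case.
elim: k => [|k [IH0 IH1]]; first by split; rewrite /= ?expr0 ?expr1; ring.
split=> //; rewrite impulseSS IH0 IH1 !exprS -!natr1; ring.
Qed.

Lemma impulse_roots r s k :
  (r - s) * impulse (r + s) (r * s) k = r ^+ k - s ^+ k.
Proof.
suff: (r - s) * impulse (r + s) (r * s) k = r ^+ k - s ^+ k /\
  (r - s) * impulse (r + s) (r * s) k.+1 = r ^+ k.+1 - s ^+ k.+1 by case.
elim: k => [|k [IH0 IH1]]; first by split; rewrite /= ?expr0 ?expr1; ring.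
split=> //; rewrite impulseSS mulrBr !mulrA IH0 IH1 !exprS; ring.
Qed.

(** The companion matrix has determinant [b], and the quadratic form on the
    left is multiplied by that determinant at every step. *)
Lemma impulse_invariant p b k :
  impulse p b k.+1 ^+ 2 - p * impulse p b k.+1 * impulse p b k
    + b * impulse p b k ^+ 2 = b ^+ k.
Proof.
elim: k => [|k IH]; first by rewrite /=; ring.
rewrite [RHS]exprS -IH impulseSS; ring.
Qed.

(** Analogue of the bound |U_k| <= k+1 for Chebyshev polynomials of the second
    kind: the difference u_(k+2) - (p/2) u_(k+1) plays the part of the
    first-kind polynomial, and completing the square in the invariant bounds it
    by r^(k+1). *)
Lemma impulse_nonreal_bound p r k : 0 <= r -> p ^+ 2 <= 4 * r ^+ 2 ->
  `|impulse p (r ^+ 2) k.+1| <= k.+1%:R * r ^+ k.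
Proof.
move=> r0 hp; elim: k => [|k IH]; first by rewrite /= normr1 expr0 mulr1.
set u := impulse p (r ^+ 2).
have -> : u k.+2 = p / 2 * u k.+1 + (u k.+2 - p / 2 * u k.+1).
  by ring.
apply: le_trans (ler_normD _ _) _.
have h2 : `|u k.+2 - p / 2 * u k.+1| <= r ^+ k.+1.
  rewrite -(@ler_pXn2r _ 2) ?nnegrE ?exprn_ge0// real_normK ?num_real//.
  have := impulse_invariant p (r ^+ 2) k.+1; rewrite -/u exprAC => <-.
  have : 0 <= (4 * r ^+ 2 - p ^+ 2) * u k.+1 ^+ 2.
    by rewrite mulr_ge0 ?sqr_ge0 ?subr_ge0.
  lra.
have h1 : `|p / 2 * u k.+1| <= r * (k.+1%:R * r ^+ k).
  rewrite normrM ler_pM //.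
  rewrite -(@ler_pXn2r _ 2) ?nnegrE ?normr_ge0// real_normK ?num_real//.
  lra.
apply: le_trans (lerD h1 h2) _.
by rewrite exprS -[k.+2%:R]natr1 le_eqVlt; apply/orP; left; apply/eqP; ring.
Qed.

(** Each of the first k+1 terms of the geometric series of sum 1 / (1-r) is at
    least r^k. *)
Lemma natmul_expr_bound r k : 0 <= r -> r < 1 ->
  k.+1%:R * r ^+ k <= (1 - r)^-1.
Proof.
move=> r0 r1; rewrite -[leRHS]mul1r ler_pdivlMr ?subr_gt0//.
suff: k.+1%:R * r ^+ k * (1 - r) <= 1 - r ^+ k.+1.
  by move=> h; apply: (le_trans h); rewrite gerBl exprn_ge0.
elim: k => [|k IH]; first by rewrite expr0 !mulr1 mul1r expr1.
have : r * (k.+1%:R * r ^+ k * (1 - r)) <= r * (1 - r ^+ k.+1).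
  exact: ler_wpM2l.
have : r ^+ k.+1 <= 1 by rewrite exprn_ile1// ltW.
move=> /(ler_wpM2r (ltW (etrans (subr_gt0 _ _) r1))).
rewrite -[k.+2%:R]natr1 !exprS; set t := r ^+ k; set c := k.+1%:R.
lra.
Qed.

Lemma nonreal_mode_bound p r k : 0 <= r -> r < 1 -> p ^+ 2 <= 4 * r ^+ 2 ->
  impulse p (r ^+ 2) k.+1 ^+ 2 + (r ^+ 2 * impulse p (r ^+ 2) k) ^+ 2
    <= 2 / (1 - r) ^+ 2.
Proof.
move=> r0 r1 hp.
have bnd j : impulse p (r ^+ 2) j ^+ 2 <= (1 - r) ^- 2.
  case: j => [|j]; first by rewrite /= expr0n/= invr_ge0 sqr_ge0.
  rewrite -exprVn -(@real_normK _ (impulse _ _ _)) ?num_real//.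
  rewrite lerXn2r ?nnegrE ?invr_ge0 ?subr_ge0 ?(ltW r1)//.
  exact: le_trans (impulse_nonreal_bound _ _ _ r0 hp) (natmul_expr_bound _ _ r0 r1).
have r4 : (r ^+ 2) ^+ 2 <= 1 by rewrite -exprM exprn_ile1// ltW.
rewrite exprMn (mulr2n 1) mulrDl mul1r lerD//.
apply: le_trans (bnd k); exact: ler_piMl (sqr_ge0 _) r4.
Qed.

End Scalar.

Section RealMode.
Variable R : rcfType.
Implicit Types p b q r s F : R.

(** With real roots r >= s, u_k = (r^k - s^k) / (r - s); the hypotheses on [p]
    and [b] place both roots in [0, 1], so the numerator is at most 1. *)
Lemma impulse_real_bound p b k : 0 <= b -> 0 <= p -> p <= 2 -> p <= 1 + b ->
  0 <= p ^+ 2 - 4 * b -> (p ^+ 2 - 4 * b) * impulse p b k ^+ 2 <= 1.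
Proof.
move=> b0 p0 p2 pb D0; set d := Num.sqrt (p ^+ 2 - 4 * b).
have d0 : 0 <= d := sqrtr_ge0 _.
have dE : d ^+ 2 = p ^+ 2 - 4 * b by rewrite sqr_sqrtr.
pose r := (p + d) / 2; pose s := (p - d) / 2.
have rsD : r - s = d by rewrite /r /s; field.
have rs : r + s = p by rewrite /r /s; field.
have rsM : r * s = b.
  have -> : r * s = (p ^+ 2 - d ^+ 2) / 4 by rewrite /r /s; field.
  by rewrite dE; field.
have dp : d <= p by rewrite -(@ler_pXn2r _ 2)// dE; lra.
have dp2 : d <= 2 - p by rewrite -(@ler_pXn2r _ 2)// ?nnegrE ?subr_ge0// dE; lra.
have s0 : 0 <= s by rewrite /s; lra.
have sr : s <= r by rewrite /r /s; lra.
have r1 : r <= 1 by rewrite /r; lra.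
rewrite -dE -exprMn -rsD -{1}rs -rsM impulse_roots.
have rk1 : r ^+ k <= 1 by rewrite exprn_ile1// (le_trans s0).
have sk0 : 0 <= s ^+ k by rewrite exprn_ge0.
have srk : s ^+ k <= r ^+ k by rewrite lerXn2r ?nnegrE// (le_trans s0).
rewrite exprn_ile1 ?subr_ge0//; lra.
Qed.

(** The discriminant factors as ((1-r)^2 - q^2) ((1+r)^2 - q^2).  The first
    factor is at least (F^2-1) q^2; the second is at least
    p = 1 + r^2 - q^2, which absorbs the factor 1 + r^4 <= 2 p arising from
    the two terms on the left. *)
Lemma real_mode_bound F q r k : 0 < q -> 4 * q ^+ 2 <= 1 -> 0 <= r ->
  1 < F -> r <= 1 - F * q ->
  impulse (1 + r ^+ 2 - q ^+ 2) (r ^+ 2) k.+1 ^+ 2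
    + (r ^+ 2 * impulse (1 + r ^+ 2 - q ^+ 2) (r ^+ 2) k) ^+ 2
    <= 2 / ((F ^+ 2 - 1) * q ^+ 2).
Proof.
move=> q0 q4 r0 F1 rF; set p := 1 + _ - _.
have Fq0 : q < F * q by rewrite ltr_pMl.
have r1 : r <= 1 by lra.
have rr : r ^+ 2 <= 1 by rewrite exprn_ile1.
have rr0 : 0 <= r ^+ 2 by rewrite exprn_ge0.
have q20 : 0 < q ^+ 2 by rewrite exprn_gt0.
pose g := (F ^+ 2 - 1) * q ^+ 2.
have g0 : 0 < g by rewrite mulr_gt0// subr_gt0 expr_gt1 ?ltW// (lt_trans _ F1).
have hD : p ^+ 2 - 4 * r ^+ 2 = ((1 - r) ^+ 2 - q ^+ 2) * ((1 + r) ^+ 2 - q ^+ 2).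
  by rewrite /p; ring.
have hg : g <= (1 - r) ^+ 2 - q ^+ 2.
  rewrite /g mulrBl mul1r lerB// -exprMn lerXn2r ?nnegrE; lra.
have he : p <= (1 + r) ^+ 2 - q ^+ 2 by rewrite /p; lra.
have p0 : 0 < p by rewrite /p; lra.
have gD : g * p <= p ^+ 2 - 4 * r ^+ 2 by rewrite hD; apply: ler_pM => //; exact: ltW.
have D0 := le_trans (ltW (mulr_gt0 g0 p0)) gD.
have bnd j : g * p * impulse p (r ^+ 2) j ^+ 2 <= 1.
  apply: le_trans (ler_wpM2r (sqr_ge0 _) gD) _.
  by apply: impulse_real_bound; rewrite // /p; lra.
rewrite -/g ler_pdivlMr// -(ler_pM2r p0).
have := bnd k.+1; have := bnd k; set x := impulse _ _ k.+1; set y := impulse _ _ k.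
move=> hy hx.
have : r ^+ 2 * r ^+ 2 * (g * p * y ^+ 2) <= r ^+ 2 * r ^+ 2 * 1 by rewrite ler_wpM2l ?mulr_ge0.
have : r ^+ 2 * r ^+ 2 <= r ^+ 2 * 1 by rewrite ler_wpM2l.
have pE : p = 1 + r ^+ 2 - q ^+ 2 by [].
move: hx; clearbody x y; clear - pE p0 rr rr0 q4; clearbody p; lra.
Qed.

End RealMode.

(** * Spectral norm of an average *)

Section Spectral.
Variable R : realType.

Lemma norm2_ge0 n (x : 'cV[R]_n) : 0 <= norm2 x.
Proof. exact: sqrtr_ge0. Qed.

Lemma norm2_sqrE n (x : 'cV[R]_n) : norm2 x ^+ 2 = \sum_i x i 0 ^+ 2.
Proof. by rewrite sqr_sqrtr// sumr_ge0// => i _; rewrite sqr_ge0. Qed.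

Lemma norm20 n : norm2 (0 : 'cV[R]_n) = 0.
Proof. by rewrite /norm2 big1 ?sqrtr0// => i _; rewrite mxE expr0n. Qed.

Lemma norm2Z n a (x : 'cV[R]_n) : norm2 (a *: x) = `|a| * norm2 x.
Proof.
rewrite /norm2 -sqrtr_sqr -sqrtrM ?sqr_ge0// mulr_sumr.
by congr Num.sqrt; apply: eq_bigr => i _; rewrite mxE exprMn.
Qed.

Lemma spectral_norm_le m n (M : 'M[R]_(m, n)) K :
  (forall x, norm2 x <= 1 -> norm2 (M *m x) <= K) -> spectral_norm M <= K.
Proof.
move=> h; apply: ge_sup => [|_ [x /= x1 <-]]; last exact: h.
by exists (norm2 (M *m 0)), 0 => //=; rewrite norm20 ler01.
Qed.

(** The supremum defining the spectral norm is that of a bounded set: the sums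
    of absolute values of the rows give a crude bound. *)
Lemma spectral_norm_ge m n (M : 'M[R]_(m, n)) x :
  norm2 x <= 1 -> norm2 (M *m x) <= spectral_norm M.
Proof.
move=> x1; apply: ub_le_sup; last by exists x.
exists (Num.sqrt (\sum_i (\sum_j `|M i j|) ^+ 2)) => _ [y /= y1 <-].
rewrite ler_wsqrtr//; apply: ler_sum => i _.
rewrite -(@real_normK _ (_ i 0)) ?num_real// lerXn2r ?nnegrE//.
  by apply: sumr_ge0.
rewrite mxE; apply: le_trans (ler_norm_sum _ _ _) _; apply: ler_sum => j _.
rewrite normrM ler_piMr// -(@ler_pXn2r _ 2) ?nnegrE// real_normK ?num_real// expr1n.
apply: le_trans (_ : norm2 y ^+ 2 <= 1); last by rewrite exprn_ile1 ?norm2_ge0.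
by rewrite norm2_sqrE (bigD1 j)//= lerDl sumr_ge0// => l _; rewrite sqr_ge0.
Qed.

(** Jensen's inequality for the square, applied coordinate by coordinate; it
    replaces the triangle inequality when all terms have a common bound. *)
Lemma norm2_sum_sqr n m (v : nat -> 'cV[R]_n) :
  norm2 (\sum_(0 <= t < m) v t) ^+ 2
    <= m%:R * \sum_(0 <= t < m) norm2 (v t) ^+ 2.
Proof.
rewrite norm2_sqrE.
have -> : \sum_(0 <= t < m) norm2 (v t) ^+ 2 = \sum_i \sum_(0 <= t < m) v t i 0 ^+ 2.
  by rewrite exchange_big; apply: eq_bigr => t _; rewrite norm2_sqrE.
rewrite mulr_sumr; apply: ler_sum => i _; rewrite summxE.
elim: m => [|m IH]; first by rewrite !big_nil expr0n mul0r.
rewrite !big_nat_recr //= -natr1.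
move: IH; set S := \sum_(0 <= j < m) _; set Q := \sum_(0 <= j < m) _; set a := v m i 0 => IH.
suff : 2 * S * a <= Q + m%:R * a ^+ 2 by lra.
have Q0 : 0 <= Q by apply: sumr_ge0 => t _; rewrite sqr_ge0.
have : 0 <= m%:R :> R by [].
rewrite le_eqVlt => /orP[/eqP m0|m0].
  move: IH; rewrite -m0 mul0r => S0.
  have /eqP -> : S == 0 by rewrite -sqrf_eq0 eq_le S0 sqr_ge0.
  by rewrite mulr0 !mul0r addr0.
rewrite -(ler_pM2l m0).
(* 2 S a <= S^2 / m + m a^2, and S^2 / m <= Q by induction. *)
have := sqr_ge0 (S - m%:R * a); lra.
Qed.

Lemma spectral_norm_average m n (M : nat -> 'M[R]_(m, n)) k K :
  (forall t, (t <= k)%N -> spectral_norm (M t) <= K) ->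
  spectral_norm (k.+1%:R^-1 *: \sum_(0 <= t < k.+1) M t) <= K.
Proof.
move=> hK; apply: spectral_norm_le => x x1.
have bnd t : (t <= k)%N -> norm2 (M t *m x) <= K.
  by move=> tk; apply: le_trans (spectral_norm_ge _ _ _ _ x1) (hK _ tk).
have K0 : 0 <= K := le_trans (norm2_ge0 _ _) (bnd 0%N isT).
have k0 : 0 < k.+1%:R :> R by rewrite ltr0n.
rewrite -scalemxAl norm2Z ger0_norm ?invr_ge0// ler_pdivrMl//.
rewrite -(@ler_pXn2r _ 2) ?nnegrE ?norm2_ge0 ?mulr_ge0//.
rewrite mulmx_suml; apply: le_trans (norm2_sum_sqr _ _ _) _.
rewrite exprMn [k.+1%:R ^+ 2]expr2 -mulrA ler_wpM2l//.
rewrite mulr_natl -[X in _ *+ X]subn0 -sumr_const_nat.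
by apply: ler_sum_nat => t tk; rewrite lerXn2r ?nnegrE ?norm2_ge0 ?bnd.
Qed.

End Spectral.

(** * Polynomials in a symmetric matrix *)

Lemma interpolation (F : fieldType) (f : F -> F) (s : seq F) :
  exists p : {poly F}, forall x, x \in s -> p.[x] = f x.
Proof.
elim: s => [|a s [p hp]]; first by exists 0.
have [as_|nas] := boolP (a \in s).
  by exists p => x; rewrite in_cons => /orP[/eqP->|]; apply: hp.
pose w := \prod_(y <- s) ('X - y%:P).
have wa : w.[a] != 0.
  by have := root_prod_XsubC s a; rewrite (negbTE nas) => /negbT.
exists (p + ((f a - p.[a]) / w.[a]) *: w) => x.
rewrite in_cons hornerD hornerZ => /orP[/eqP->|xs]; first by rewrite divfK// addrC subrK.
have /rootP -> : root w x by rewrite root_prod_XsubC.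
by rewrite mulr0 addr0 hp.
Qed.

Section Symmetric.
Variable R : realType.

Lemma norm2_sqr n (x : 'cV[R]_n) : norm2 x ^+ 2 = (x^T *m x) 0 0.
Proof. by rewrite norm2_sqrE mxE; apply: eq_bigr => i _; rewrite mxE expr2. Qed.

Lemma norm2_eq0 n (x : 'cV[R]_n) : norm2 x = 0 -> x = 0.
Proof.
move=> x0; have /eqP : \sum_i x i 0 ^+ 2 = 0 by rewrite -norm2_sqrE x0 expr0n.
rewrite psumr_eq0; last by move=> i _; rewrite sqr_ge0.
move=> /allP h; apply/matrixP => i j; rewrite ord1 mxE.
by have := h i (mem_index_enum i); rewrite sqrf_eq0 => /eqP.
Qed.

(** A symmetric C with C^2 = 0 vanishes, since the diagonal of C^2 = C^T C holds
    the squared norms of the columns of C; iterate on the exponents 2^k. *)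
Lemma sym_nilpotent n (B : 'M[R]_n.+1) k : B^T = B -> B ^+ k = 0 -> B = 0.
Proof.
move=> Bs Bk; have {Bk} : B ^+ (2 ^ k) = 0.
  by rewrite -(subnK (ltnW (ltn_expl k (leqnn 2)))) exprD Bk mulr0.
elim: k => [|k IH]; first by rewrite expn0 expr1.
move=> h; apply: IH; set C := B ^+ (2 ^ k).
have Cs : C^T = C.
  by rewrite /C; elim: (2 ^ k)%N => [|m IHm]; rewrite ?expr0 ?trmx1// exprS trmx_mul IHm Bs mulmxE -exprSr exprS.
have CC : C *m C = 0 by rewrite -[RHS]h expnS mulnC exprM expr2.
apply/matrixP => i j; have := congr1 (fun M : 'M[R]_n.+1 => M j j) CC.
rewrite !mxE => /eqP; rewrite (eq_bigr (fun l => C l j ^+ 2)); last first.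
  by move=> l _; rewrite -{1}Cs mxE expr2.
rewrite psumr_eq0; last by move=> l _; rewrite sqr_ge0.
by move=> /allP /(_ i (mem_index_enum i)); rewrite sqrf_eq0 => /eqP.
Qed.

Lemma horner_mx_sym n (A : 'M[R]_n.+1) (p : {poly R}) :
  A^T = A -> (horner_mx A p)^T = horner_mx A p.
Proof.
move=> As; elim/poly_ind: p => [|p c IH]; first by rewrite rmorph0 trmx0.
rewrite rmorphD rmorphM /= horner_mx_X horner_mx_C linearD /= tr_scalar_mx.
congr (_ + _); have pA : horner_mx A p *m A = A *m horner_mx A p.
  by have := rmorphM (horner_mx A) p 'X; rewrite mulrC rmorphM /= horner_mx_X.
by rewrite trmx_mul IH As -pA.
Qed.

(** A form of the spectral theorem that avoids diagonalization.  Interpolate the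
    square root of [h] on the spectrum by a polynomial p.  Then h - p^2 vanishes
    at every eigenvalue, so by Cayley-Hamilton h(A) - p(A)^2 is nilpotent; being
    symmetric, it is 0, and h(A) = p(A)^2 is the square of a symmetric matrix. *)
Lemma horner_mx_psd n (A : 'M[R]_n.+1) (s : seq R) (h : {poly R}) (x : 'cV[R]_n.+1) :
  A^T = A -> char_poly A = \prod_(l <- s) ('X - l%:P) ->
  (forall l, l \in s -> 0 <= h.[l]) -> 0 <= (x^T *m horner_mx A h *m x) 0 0.
Proof.
move=> As cA h0; have [p hp] := interpolation _ (fun y => Num.sqrt h.[y]) s.
pose g := h - p ^+ 2.
have g0 l : l \in s -> root g l.
  by move=> ls; rewrite /root !hornerE hp// sqr_sqrtr ?subrr ?h0.
have gn : char_poly A %| g ^+ size s.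
  rewrite cA; elim: s {cA h0 hp} g0 => [|l s IH] g0; first by rewrite big_nil dvd1p.
  rewrite big_cons exprS dvdp_mul//; first by rewrite dvdp_XsubCl g0// mem_head.
  by apply: IH => y ys; apply: g0; rewrite in_cons ys orbT.
have : horner_mx A g = 0.
  apply: (@sym_nilpotent _ _ (size s)); first exact: horner_mx_sym.
  have /dvdpP[v vE] := gn.
  by rewrite -rmorphXn vE rmorphM /= Cayley_Hamilton mulr0.
rewrite /g rmorphB rmorphXn /= => /eqP; rewrite subr_eq0 => /eqP ->.
have -> : x^T *m horner_mx A p ^+ 2 *m x
    = (horner_mx A p *m x)^T *m (horner_mx A p *m x).
  by rewrite trmx_mul horner_mx_sym// expr2 -!mulmxA.
by rewrite -norm2_sqr sqr_ge0.
Qed.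

Lemma norm2_col_mx m n (y : 'cV[R]_m) (z : 'cV[R]_n) :
  norm2 (col_mx y z) ^+ 2 = norm2 y ^+ 2 + norm2 z ^+ 2.
Proof. by rewrite !norm2_sqr tr_col_mx mul_row_col mxE. Qed.

(** P = p(A) and Q = q(A) are symmetric and commute, so
    |P y + Q z|^2 + |Q y - P z|^2 is the sum of the values at y and z of the
    quadratic form P^2 + Q^2, and this form is at most K times the identity. *)
Lemma norm2_row_poly n (A : 'M[R]_n.+1) (s : seq R) (p q : {poly R}) K :
  A^T = A -> char_poly A = \prod_(l <- s) ('X - l%:P) ->
  (forall l, l \in s -> p.[l] ^+ 2 + q.[l] ^+ 2 <= K) ->
  forall x, norm2 (row_mx (horner_mx A p) (horner_mx A q) *m x) ^+ 2
    <= K * norm2 x ^+ 2.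
Proof.
move=> As cA hK x; rewrite -(vsubmxK x); set y := usubmx x; set z := dsubmx x.
rewrite norm2_col_mx mul_row_col.
set P := horner_mx A p; set Q := horner_mx A q.
have PQ : P *m Q = Q *m P.
  by have := rmorphM (horner_mx A) p q; rewrite mulrC rmorphM.
have Ps : P^T = P := horner_mx_sym _ _ _ As.
have Qs : Q^T = Q := horner_mx_sym _ _ _ As.
pose h := K%:P - (p ^+ 2 + q ^+ 2).
have psd w : (w^T *m (P *m P + Q *m Q) *m w) 0 0 <= K * norm2 w ^+ 2.
  have : 0 <= (w^T *m horner_mx A h *m w) 0 0.
    apply: (@horner_mx_psd _ _ s) => // l ls.
    by rewrite !hornerE subr_ge0 hK.
  rewrite /h rmorphB rmorphD !rmorphXn /= horner_mx_C mulmxBr mulmxBl.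
  rewrite mul_mx_scalar -scalemxAl -/P -/Q !expr2 -!mulmxE -!expr2 norm2_sqr.
  by rewrite [X in 0 <= X]mxE [X in X + _]mxE [X in _ + X]mxE subr_ge0.
have parallel : norm2 (P *m y + Q *m z) ^+ 2 + norm2 (Q *m y - P *m z) ^+ 2
    = (y^T *m (P *m P + Q *m Q) *m y) 0 0 + (z^T *m (P *m P + Q *m Q) *m z) 0 0.
  rewrite !norm2_sqr !linearB !linearD /= !trmx_mul Ps Qs.
  rewrite !(mulmxDl, mulmxDr, mulmxN, mulNmx) !mulmxA.
  rewrite -!(mulmxA _ Q P) -!PQ !mulmxA !mxE; ring.
rewrite mulrDr; apply: le_trans (lerD (psd y) (psd z)).
by rewrite -parallel lerDl sqr_ge0.
Qed.

End Symmetric.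

(** * Deviations as scalar recurrences on the spectrum *)

Section HeavyBall.
Variable R : realType.

Lemma HB_row n (A : 'M[R]_n) alpha beta k (P := (1 + beta)%:M - alpha *: A) :
  HB_C R n *m HB_T A alpha beta ^+ k.+1
  = row_mx (impulse P beta%:M k.+1) (- (impulse P beta%:M k *m beta%:M)).
Proof.
elim: k => [|k IH].
  rewrite expr1 /HB_C /HB_T mul_row_block /= !mul0mx !mul1mx !add0r.
  by rewrite oppr0.
rewrite exprSr -mulmxE mulmxA IH /HB_T mul_row_block mulmx1 mulmx0 addr0.
by rewrite impulseSS mulmxN.
Qed.

Lemma HB_row_horner n (A : 'M[R]_n.+1) alpha beta k
    (p := impulse ((1 + beta)%:P - alpha *: 'X) beta%:P) :
  HB_C R n.+1 *m HB_T A alpha beta ^+ k.+1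
  = row_mx (horner_mx A (p k.+1)) (horner_mx A (- (p k * beta%:P))).
Proof.
have pA : horner_mx A ((1 + beta)%:P - alpha *: 'X) = (1 + beta)%:M - alpha *: A.
  by rewrite rmorphB /= horner_mxZ horner_mx_C horner_mx_X.
have E j : horner_mx A (p j) = impulse ((1 + beta)%:M - alpha *: A) beta%:M j.
  by rewrite -(horner_mx_C A beta) -pA; exact: (rmorph_impulse _ _ (horner_mx A)).
have M : horner_mx A (- (p k * beta%:P)) = - (horner_mx A (p k) *m beta%:M).
  by rewrite rmorphN rmorphM [X in - (_ * X)]horner_mx_C.
by rewrite HB_row M !E.
Qed.

Lemma horner_impulse (alpha beta l : R) k :
  (impulse ((1 + beta)%:P - alpha *: 'X) beta%:P k).[l]
  = impulse (1 + beta - alpha * l) beta k.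
Proof.
rewrite -[LHS]/(horner_eval l _) (rmorph_impulse _ _ (horner_eval l)).
by congr (impulse _ _ k); rewrite /= /horner_eval !hornerE.
Qed.

(** The bound 1 <= K takes care of k = 0, where the row is C itself and is not
    of the form given by [HB_row_horner]. *)
Lemma dev_HB_le n (A : 'M[R]_n.+1) (s : seq R) alpha beta K :
  A^T = A -> char_poly A = \prod_(l <- s) ('X - l%:P) -> 1 <= K ->
  (forall l k, l \in s ->
    impulse (1 + beta - alpha * l) beta k.+1 ^+ 2
      + (beta * impulse (1 + beta - alpha * l) beta k) ^+ 2 <= K ^+ 2) ->
  (dev_HB A alpha beta <= K%:E)%E.
Proof.
move=> As cA K1 hK; have K0 : 0 <= K by apply: le_trans K1.
apply: ge_ereal_sup => _ [k _ <-]; rewrite lee_fin.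
apply: spectral_norm_le => x x1; rewrite -(@ler_pXn2r _ 2) ?nnegrE ?norm2_ge0//.
have xx : norm2 x ^+ 2 <= 1 by rewrite exprn_ile1 ?norm2_ge0.
case: k => [|k].
  apply: le_trans (_ : 1 <= _); last by rewrite exprn_ege1.
  rewrite expr0 mulmx1; apply: le_trans xx.
  by rewrite -[x]vsubmxK mul_row_col mul0mx mul1mx add0r norm2_col_mx lerDr sqr_ge0.
rewrite HB_row_horner; apply: le_trans (_ : K ^+ 2 * norm2 x ^+ 2 <= _); last first.
  by rewrite ler_piMr// sqr_ge0.
apply: (@norm2_row_poly _ _ _ s) => // l ls.
by rewrite hornerN hornerM hornerC sqrrN !horner_impulse [_ * beta]mulrC hK.
Qed.

Lemma eigenvector_unit n (A : 'M[R]_n) l : A^T = A -> root (char_poly A) l ->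
  exists2 w : 'cV[R]_n, A *m w = l *: w & norm2 w = 1.
Proof.
move=> As; rewrite -eigenvalue_root_char => /eigenvalueP[v vA v0].
pose w := v^T; have w0 : norm2 w != 0.
  by apply: contra_neq v0 => /norm2_eq0 wE; rewrite -[v]trmxK -/w wE trmx0.
exists ((norm2 w)^-1 *: w); last first.
  by rewrite norm2Z ger0_norm ?mulVf// invr_ge0 norm2_ge0.
by rewrite -scalemxAr /w -{1}As -trmx_mul vA linearZ /= scalerA mulrC -scalerA.
Qed.

Lemma horner_mx_eigenvector n (A : 'M[R]_n.+1) (w : 'cV[R]_n.+1) l (p : {poly R}) :
  A *m w = l *: w -> horner_mx A p *m w = p.[l] *: w.
Proof.
move=> Aw; elim/poly_ind: p => [|p c IH].
  by rewrite rmorph0 horner0 scale0r mul0mx.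
rewrite rmorphD rmorphM /= horner_mx_X horner_mx_C mulmxDl mul_scalar_mx.
by rewrite -mulmxE -mulmxA Aw -scalemxAr IH !hornerE scalerDl scalerA mulrC.
Qed.

(** Apply the row C T^(k+1) to (w, 0) with w a unit eigenvector for [l]. *)
Lemma dev_HB_ge n (A : 'M[R]_n.+1) alpha beta l k :
  A^T = A -> root (char_poly A) l ->
  ((impulse (1 + beta - alpha * l) beta k.+1)%:E <= dev_HB A alpha beta)%E.
Proof.
move=> As lA; have [w Aw w1] := eigenvector_unit _ _ _ As lA.
apply: le_ereal_sup_tmp; exists (spectral_norm (HB_C R n.+1 *m HB_T A alpha beta ^+ k.+1))%:E.
  by exists k.+1.
rewrite lee_fin; have w01 : norm2 (col_mx w (0 : 'cV_n.+1)) <= 1.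
  rewrite -(@ler_pXn2r _ 2) ?nnegrE ?norm2_ge0// norm2_col_mx w1.
  by rewrite norm20 expr0n addr0.
apply: le_trans (spectral_norm_ge _ _ _ _ _ w01).
rewrite HB_row_horner mul_row_col mulmx0 addr0 (horner_mx_eigenvector _ _ _ _ _ Aw).
by rewrite norm2Z w1 mulr1 horner_impulse ler_norm.
Qed.

(** The k-th average is bounded by the largest of the finitely many norms that
    enter it, so an infinite deviation needs no separate treatment. *)
Lemma dev_AHB_le_dev_HB n (A : 'M[R]_n) alpha beta :
  (dev_AHB A alpha beta <= dev_HB A alpha beta)%E.
Proof.
apply: ge_ereal_sup => _ [k _ <-].
pose f (t : 'I_k.+1) := spectral_norm (HB_C R n *m HB_T A alpha beta ^+ t).
have [t _ ht] := @arg_maxP _ _ _ ord0 xpredT f isT.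
apply: le_ereal_sup_tmp; exists (f t)%:E; first by exists t.
rewrite lee_fin; apply: spectral_norm_average => j jk.
by have := ht (Ordinal (jk : (j < k.+1)%N)) isT.
Qed.

Lemma posdef_eigenvalue_gt0 n (A : 'M[R]_n) l :
  positive_definite A -> root (char_poly A) l -> 0 < l.
Proof.
move=> [As pA] lA; have [w Aw w1] := eigenvector_unit _ _ _ As lA.
have w0 : w != 0 by apply: contra_eq_neq w1 => ->; rewrite norm20 eq_sym oner_eq0.
have := pA w w0; rewrite -mulmxA Aw -scalemxAr mxE -norm2_sqr w1 expr1n.
by rewrite mulr1.
Qed.

(** The cube of exp (1/3) >= 4/3. *)
Lemma expR1_ge : 64 / 27 <= expR 1 :> R.
Proof.
have h : 4 / 3 <= expR 3^-1 :> R by apply: le_trans (expR_ge1Dx _); lra.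
have -> : expR 1 = expR 3^-1 ^+ 3 :> R.
  by rewrite [RHS]exprS expr2 -!expRD; congr expR; field.
have -> : 64 / 27 = (4 / 3) ^+ 3 :> R by field.
by rewrite lerXn2r ?nnegrE ?expR_ge0//; lra.
Qed.

Lemma bernoulli (r : R) m : 0 <= r -> r <= 1 -> 1 - m%:R * (1 - r) <= r ^+ m.
Proof.
move=> r0 r1; elim: m => [|m IH]; first by rewrite mul0r subr0 expr0.
have := ler_wpM2l r0 IH; rewrite -exprS; apply: le_trans.
rewrite -natr1; have := sqr_ge0 (1 - r).
by move=> /(ler_wpM2l (ler0n R m)); lra.
Qed.

(** The maximum of (k+1) r^k is reached for k about 1/(2q), but k = 1/(4q)
    rounded down is where Bernoulli's inequality is most efficient: there
    k (1-r) <= 2 k q <= 1/2. *)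
Lemma optimal_mode_large (q : R) (r := (1 - q) / (1 + q)) : 0 < q -> q <= 1 ->
  exists k, (8 * q)^-1 <= impulse (2 * r) (r ^+ 2) k.+1.
Proof.
move=> q0 q1; have q10 : 0 < 1 + q by lra.
have r0 : 0 <= r by apply: divr_ge0; lra.
have rE : 1 - r = 2 * q / (1 + q) by rewrite /r; field; rewrite gt_eqF.
have r2q : 1 - r <= 2 * q.
  by rewrite rE ler_pdivrMr// ler_peMr; lra.
have r1 : r <= 1 by rewrite -subr_ge0 rE; apply: divr_ge0; lra.
pose m := Num.truncn (4 * q)^-1; exists m; rewrite impulse_double_root.
have q40 : 0 < 4 * q by rewrite mulr_gt0.
have /andP[m1 m2] := truncn_itv (ltW (etrans (invr_gt0 _) q40)).
rewrite -/m in m1 m2.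
have mq : m%:R * (4 * q) <= 1 by rewrite -ler_pdivlMr// mul1r.
have half : 2^-1 <= r ^+ m.
  apply: le_trans (bernoulli r m r0 r1).
  have := ler_wpM2l (ler0n R m) r2q; lra.
have -> : (8 * q)^-1 = (4 * q)^-1 * 2^-1 by field; rewrite gt_eqF.
by apply: ler_pM; rewrite ?invr_ge0 ?(ltW q40) ?(ltW m2).
Qed.

End HeavyBall.

(** * The two deviation bounds *)

Section Deviations.
Variable R : realType.

(** An eigenvalue l gives nonreal (or double) roots exactly when
    (1-r)^2 <= l/L <= (1+r)^2, the discriminant being
    (l/L - (1-r)^2) (l/L - (1+r)^2). *)
Lemma dev_HB_upper n (A : 'M[R]_n.+1) (s : seq R) (L F q r : R) :
  A^T = A -> char_poly A = \prod_(l <- s) ('X - l%:P) ->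
  0 < L -> 0 < q -> 4 * q ^+ 2 <= 1 -> 1 < F -> F * q <= 1 ->
  0 <= r -> r <= 1 - F * q ->
  (forall l, l \in s -> l = q ^+ 2 * L \/ (1 - r) ^+ 2 * L <= l <= L) ->
  (dev_HB A (1 / L) (r ^+ 2) <= (Num.sqrt 2 / (Num.sqrt (F ^+ 2 - 1) * q))%:E)%E.
Proof.
move=> As cA L0 q0 q4 F1 Fq r0 rF hs.
have F20 : 0 < F ^+ 2 - 1 by rewrite subr_gt0 expr_gt1// (le_trans ler01)// ltW.
set K := Num.sqrt 2 / _.
have K2 : K ^+ 2 = 2 / ((F ^+ 2 - 1) * q ^+ 2).
  by rewrite expr_div_n exprMn !sqr_sqrtr// ltW.
have K0 : 0 <= K by rewrite divr_ge0 ?mulr_ge0 ?sqrtr_ge0// ltW.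
have g0 : 0 < (F ^+ 2 - 1) * q ^+ 2 by rewrite mulr_gt0// exprn_gt0.
have Fq2 : F ^+ 2 * q ^+ 2 <= 1.
  by rewrite -exprMn exprn_ile1// mulr_ge0 ?ltW// (lt_trans ltr01).
have q20 : 0 < q ^+ 2 by rewrite exprn_gt0.
apply: (@dev_HB_le _ _ _ s) => //.
  rewrite -(@ler_pXn2r _ 2) ?nnegrE// expr1n K2 ler_pdivlMr// mul1r; lra.
move=> l k /hs; rewrite K2 => -[lE|/andP[l1 l2]].
  have -> : 1 + r ^+ 2 - 1 / L * l = 1 + r ^+ 2 - q ^+ 2.
    by rewrite lE; field; rewrite gt_eqF.
  exact: real_mode_bound.
set t := 1 / L * l.
have lE : l = t * L by rewrite /t; field; rewrite gt_eqF.
have t1 : (1 - r) ^+ 2 <= t by rewrite -(ler_pM2r L0) -lE.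
have t2 : t <= 1 by rewrite -(ler_pM2r L0) -lE mul1r.
have Fq0 : 0 < F * q by rewrite mulr_gt0// (lt_trans ltr01).
have r1 : r < 1 by lra.
apply: le_trans (nonreal_mode_bound _ _ _ _ r0 r1 _) _.
  rewrite -subr_ge0.
  have -> : 4 * r ^+ 2 - (1 + r ^+ 2 - t) ^+ 2 = (t - (1 - r) ^+ 2) * ((1 + r) ^+ 2 - t).
    by ring.
  by rewrite mulr_ge0 ?subr_ge0// (le_trans t2)// exprn_ege1// lerDl.
rewrite ler_pM2l// lef_pV2 ?posrE ?exprn_gt0 ?subr_gt0//.
apply: le_trans (_ : (F * q) ^+ 2 <= _); first by rewrite exprMn ler_pM2r// gerBl.
by clear As cA; rewrite lerXn2r ?nnegrE; lra.
Qed.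

(** The hypothesis on [alpha] says that at [l] the two characteristic roots are
    both equal to r. *)
Lemma dev_HB_optimal_lower n (A : 'M[R]_n.+1) (alpha l q : R)
    (r := (1 - q) / (1 + q)) :
  A^T = A -> root (char_poly A) l -> 0 < q -> q <= 1 ->
  alpha * l = (1 - r) ^+ 2 ->
  (((8 * q)^-1)%:E <= dev_HB A alpha (r ^+ 2))%E.
Proof.
move=> As lA q0 q1 al; have [k hk] := optimal_mode_large _ _ q0 q1.
apply: le_trans (dev_HB_ge _ _ _ alpha (r ^+ 2) l k As lA).
have -> : 1 + r ^+ 2 - alpha * l = 2 * r by rewrite al; ring.
by rewrite lee_fin.
Qed.

(** After simplification this is 4 <= e sqrt 3, which follows from
    e >= 64/27 and sqrt 3 >= 17/10. *)
Lemma numerical_comparison (F q : R) : 1 < F -> 0 < q ->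
  Num.sqrt 2 / (Num.sqrt (F ^+ 2 - 1) * q)
    <= 2 * expR 1 * Num.sqrt 6 / Num.sqrt (F ^+ 2 - 1) * (8 * q)^-1.
Proof.
move=> F1 q0.
have g0 : 0 < Num.sqrt (F ^+ 2 - 1).
  by rewrite sqrtr_gt0 subr_gt0 expr_gt1// (le_trans ler01)// ltW.
have s3 : 17 / 10 <= Num.sqrt 3 :> R.
  by rewrite -(@ler_pXn2r _ 2) ?nnegrE ?sqrtr_ge0 ?sqr_sqrtr//; lra.
have -> : Num.sqrt 6 = Num.sqrt 2 * Num.sqrt 3 :> R.
  by rewrite -sqrtrM//; congr Num.sqrt; ring.
set g := Num.sqrt (F ^+ 2 - 1) in g0 *.
have -> : 2 * expR 1 * (Num.sqrt 2 * Num.sqrt 3) / g * (8 * q)^-1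
    = Num.sqrt 2 / (g * q) * (expR 1 * Num.sqrt 3 / 4).
  by field; rewrite !gt_eqF.
rewrite ler_peMr//; first by rewrite divr_ge0 ?sqrtr_ge0// mulr_ge0 ?ltW.
have h0 : 0 <= 64 / 27 :> R by lra.
have h1 : 0 <= 17 / 10 :> R by lra.
have := ler_pM h0 h1 (expR1_ge R) s3; lra.
Qed.

End Deviations.

Theorem theorem2p3 (R : realType) (n : nat) (A : 'M[R]_n)
    (lambda : n.-tuple R) (F alpha beta alphas betas : R)
    (lambda1 := lambda`_0) (lambda2 := lambda`_1) (lambdan := lambda`_n.-1) :
  (2 <= n)%N ->
  positive_definite A ->
  sorted_eigenvalues A lambda ->
  14 < F ->
  F <= Num.sqrt (lambdan / lambda1) ->
  F ^+ 2 * lambda1 <= lambda2 ->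
  10000 * lambda1 <= lambdan ->
  alpha = 1 / lambdan ->
  (1 - Num.sqrt (lambda2 / lambdan)) ^+ 2 < beta ->
  beta <= (1 - F * Num.sqrt (lambda1 / lambdan)) ^+ 2 ->
  alphas = 4 / (Num.sqrt lambdan + Num.sqrt lambda1) ^+ 2 ->
  betas = ((Num.sqrt lambdan - Num.sqrt lambda1)
             / (Num.sqrt lambdan + Num.sqrt lambda1)) ^+ 2 ->
  (dev_AHB A alpha beta <= dev_HB A alpha beta)%E /\
  (dev_HB A alpha beta <=
     (2 * expR 1 * Num.sqrt 6 / Num.sqrt (F ^+ 2 - 1))%:E
       * dev_HB A alphas betas)%E.
Proof.
move=> n2 pA [srt cA] F14 FL _ L1 -> hb1 hb2 -> ->.
split; first exact: dev_AHB_le_dev_HB.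
case: n => [//|n] in A lambda @lambda1 @lambda2 @lambdan n2 pA srt cA FL L1 hb1 hb2 *.
have As : A^T = A by case: pA.
have szl : size lambda = n.+1 by rewrite size_tuple.
have rootE l : root (char_poly A) l = (l \in lambda) by rewrite cA root_prod_XsubC.
have le_nth i j : (i <= j < n.+1)%N -> lambda`_i <= lambda`_j.
  move=> /andP[ij jn]; apply: (sorted_leq_nth le_trans le_refl 0 srt) => //.
    by rewrite inE szl (leq_ltn_trans ij).
  by rewrite inE szl.
have l1A : root (char_poly A) lambda1 by rewrite rootE mem_nth ?szl.
have l0 : 0 < lambda1 := posdef_eigenvalue_gt0 _ _ _ _ pA l1A.
have L0 : 0 < lambdan by lra.
pose q := Num.sqrt (lambda1 / lambdan).
have q2 : q ^+ 2 = lambda1 / lambdan by rewrite sqr_sqrtr// divr_ge0 ?ltW.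
have q0 : 0 < q by rewrite sqrtr_gt0 divr_gt0.
have q4 : 4 * q ^+ 2 <= 1 by rewrite q2 mulrA ler_pdivrMr//; lra.
have F1 : 1 < F by lra.
have Fq : F * q <= 1.
  rewrite -ler_pdivlMr// mul1r /q -sqrtrV ?invf_div//.
  by rewrite divr_ge0 ?ltW.
have q1 : q <= 1 by apply: le_trans Fq; rewrite ler_peMl// ltW.
have b0 : 0 <= beta by apply: le_trans (ltW hb1); rewrite sqr_ge0.
pose r := Num.sqrt beta.
have r0 : 0 <= r by rewrite sqrtr_ge0.
have bE : beta = r ^+ 2 by rewrite sqr_sqrtr.
have rF : r <= 1 - F * q.
  by rewrite -(@ler_pXn2r _ 2) ?nnegrE ?subr_ge0// -bE.
have up : (dev_HB A (1 / lambdan) beta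
    <= (Num.sqrt 2 / (Num.sqrt (F ^+ 2 - 1) * q))%:E)%E.
  rewrite bE; apply: (@dev_HB_upper _ _ _ lambda) => // l /(nthP 0)[j].
  rewrite szl => jn <-.
  case: j jn => [|j] jn.
    by left; rewrite q2 divfK// gt_eqF.
  right; rewrite le_nth ?andbT; last by rewrite /= ltnSn andbT.
  apply: le_trans (_ : _ <= lambda2) _; last exact: le_nth.
  rewrite -ler_pdivlMr//.
  have l2L : 0 <= lambda2 / lambdan.
    by rewrite divr_ge0 ?(ltW L0)// (le_trans (ltW l0))// le_nth.
  rewrite -[leRHS]sqr_sqrtr// lerXn2r ?nnegrE ?sqrtr_ge0//.
    have := mulr_gt0 (lt_trans ltr01 F1) q0; lra.
  have : 1 - Num.sqrt (lambda2 / lambdan) <= r.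
    rewrite -(@ler_pXn2r _ 2) ?nnegrE -?bE//; first exact: ltW.
    rewrite subr_ge0 -[leRHS]sqrtr1 ler_wsqrtr// ler_pdivrMr// mul1r.
    by rewrite le_nth //= ltnSn andbT.
  lra.
apply: (le_trans up).
have S0 : 0 < Num.sqrt lambdan by rewrite sqrtr_gt0.
have s0 : 0 < Num.sqrt lambda1 by rewrite sqrtr_gt0.
have qE : q = Num.sqrt lambda1 / Num.sqrt lambdan.
  by rewrite /q sqrtrM ?ltW// sqrtrV// ltW.
have l1E : lambda1 = Num.sqrt lambda1 ^+ 2 by rewrite sqr_sqrtr// ltW.
have -> : (Num.sqrt lambdan - Num.sqrt lambda1)
    / (Num.sqrt lambdan + Num.sqrt lambda1) = (1 - q) / (1 + q).
  by rewrite qE; field; rewrite !gt_eqF ?addr_gt0.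
have lo : (((8 * q)^-1)%:E
    <= dev_HB A (4 / (Num.sqrt lambdan + Num.sqrt lambda1) ^+ 2)
         (((1 - q) / (1 + q)) ^+ 2))%E.
  apply: dev_HB_optimal_lower l1A _ _ _ => //.
  by rewrite {2}l1E qE; field; rewrite !gt_eqF ?addr_gt0.
apply: le_trans (_ : (_ * ((8 * q)^-1)%:E <= _)%E); last first.
  apply: lee_wpmul2l lo.
  by rewrite lee_fin divr_ge0 ?sqrtr_ge0// !mulr_ge0 ?sqrtr_ge0 ?expR_ge0.
by rewrite -EFinM lee_fin numerical_comparison.
Qed.
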